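(* Let $b\ge2$, $d\ge1$, and let $a_1,\dots,a_d$ be positive integers coprime to $b$. Then for every $t\in\mathbb{Z}$, \[b\,S_{(a_1,\dots,a_d;b)}(t)=-\sum_{k=1}^{b-1}k\,S_{(a_1,\dots,a_{d-1};b)}(t+ka_d).\]
   Context: $\xi_b=e^{2\pi i/b}$ and $S_{(a_1,\dots,a_d;b)}(n)=\frac1b\sum_{j=1}^{b-1}\frac{\xi_b^{jn}}{(1-\xi_b^{ja_1})\cdots(1-\xi_b^{ja_d})}$; for $d=1$, $S_{(\,;b)}(n)=S_b(n)=\frac1b\sum_{j=1}^{b-1}\xi_b^{jn}$. *)

(* Defs.v *)
From mathcomp Require Import all_boot all_order all_algebra.
From mathcomp Require Import all_classical all_reals all_analysis.
From mathcomp Require Export complex.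

Set Implicit Arguments.
Unset Strict Implicit.
Unset Printing Implicit Defensive.

Import Order.TTheory GRing.Theory Num.Theory.

Local Open Scope ring_scope.
Local Open Scope complex_scope.

Definition cexp (R : realType) (z : R[i]) : R[i] :=
  (expR (complex.Re z))%:C *
    (cos (complex.Im z) +i* sin (complex.Im z)).

Definition xi (R : realType) (b : nat) : R[i] :=
  cexp ((2 * pi / b%:R : R) *i).

(* The Fourier-Dedekind sum S_(a_1,...,a_d; b)(n), where [a] lists a_1, ..., a_d.
   Division by 0 in R[i] yields 0, but no denominator vanishes when every a_i
   is coprime to b. *)
Definition fdsum (R : realType) (a : seq nat) (b : nat) (n : int) : R[i] :=
  b%:R^-1 *
    \sum_(1 <= j < b)
      (xi R b ^ (j%:Z * n) / \prod_(c <- a) (1 - xi R b ^+ (j * c))).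

(* Main.v *)
Require Import Defs.
From mathcomp Require Import all_boot all_order all_algebra.
From mathcomp Require Import all_classical all_reals all_analysis.
From mathcomp Require Import ring lra.

(** If z <> 1 and z^b = 1 then \sum_(1 <= k < b) k z^k = - b / (1 - z).  With
    z = xi^(j a_d), this trades the factor 1 / (1 - xi^(j a_d)) of each term of
    the Fourier-Dedekind sum for a weighted sum of shifts of the argument. *)

Import Order.TTheory GRing.Theory Num.Theory.

Local Open Scope ring_scope.

(** This is the differentiated geometric sum, cleared of its denominator so that it is a ring
    identity provable by induction on [n]. *)
Lemma sum_natr_expr_closed {K : comNzRingType} (z : K) (n : nat) :
  (1 - z) ^+ 2 * \sum_(0 <= k < n) k%:R * z ^+ k =
  z - n%:R * z ^+ n + (n%:R - 1) * z ^+ n.+1.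
Proof.
elim: n => [|n IHn]; first by rewrite big_geq // expr0 expr1; ring.
by rewrite big_nat_recr //= mulrDr IHn -natr1 !exprS; ring.
Qed.

(** When [z ^+ b = 1] the closed form collapses to [- b%:R * (1 - z)], and cancelling [(1 - z) ^+ 2]
    leaves a single factor in the denominator. *)
Lemma sum_natr_unity_root {F : fieldType} {z : F} {b : nat} :
  (0 < b)%N -> z ^+ b = 1 -> z != 1 ->
  \sum_(1 <= k < b) k%:R * z ^+ k = - (b%:R / (1 - z)).
Proof.
move=> b_gt0 zb z_neq1.
have z1 : 1 - z != 0 by rewrite subr_eq0 eq_sym.
have := sum_natr_expr_closed z b.
rewrite big_ltn // mul0r add0r (exprS z) zb => sumE.
apply: (mulfI (expf_neq0 2 z1)); rewrite sumE.
by field.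
Qed.

Lemma xi_exprE (R : realType) (b n : nat) :
  xi R b ^+ n =
  Complex (cos (n%:R * (2 * pi / b%:R))) (sin (n%:R * (2 * pi / b%:R))).
Proof.
have xiE : xi R b = Complex (cos (2 * pi / b%:R)) (sin (2 * pi / b%:R)).
  by rewrite /xi /cexp /= expR0 mul1r.
elim: n => [|n IHn]; first by rewrite expr0 mul0r cos0 sin0.
rewrite exprSr IHn xiE -[n.+1%:R]natr1 [(n%:R + 1) * _]mulrDl mul1r cosD sinD.
by apply/eqP; rewrite eq_complex /= addrC [X in _ && (X == _)]addrC !eqxx.
Qed.

Lemma xi_prim_root (R : realType) {b : nat} :
  (0 < b)%N -> b.-primitive_root (xi R b).
Proof.
move=> b_gt0.
have b_neq0 : b%:R != 0 :> R by rewrite pnatr_eq0 -lt0n.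
have xib : xi R b ^+ b = 1.
  rewrite xi_exprE.
  have -> : b%:R * (2 * pi / b%:R) = pi *+ 2 :> R by rewrite mulr2n; field.
  by rewrite cos2pi sin2pi.
apply/andP; split=> //; apply/forallP => i; rewrite unity_rootE.
case: (eqVneq i.+1 b) => [-> | iNb]; first by rewrite xib !eqxx.
have i_lt_b : (i.+1 < b)%N by rewrite ltn_neqAle iNb ltn_ord.
rewrite eqbF_neg; apply/negP => /eqP.
rewrite xi_exprE => -[cos1 _].
(* Half the angle of [xi R b ^+ i.+1]. It lies strictly between 0 and [pi], so [sin x > 0], and
   cos(2x) = 1 - 2 sin(x)^2 < 1 contradicts [cos1]. *)
set x : R := i.+1%:R * pi / b%:R.
have angleE : i.+1%:R * (2 * pi / b%:R) = x *+ 2 by rewrite mulr2n /x; field.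
have sin_gt0 : 0 < sin x.
  apply: sin_gt0_pi; rewrite /x; apply/andP; split.
    by rewrite !mulr_gt0 ?invr_gt0 ?ltr0n ?pi_gt0.
  by rewrite ltr_pdivrMr ?ltr0n // mulrC ltr_pM2l ?pi_gt0 // ltr_nat.
move: cos1; rewrite angleE cos_mulr2n cos2sin2 => cos1.
by have := exprn_gt0 2 sin_gt0; lra.
Qed.

(** Otherwise [b] would divide [j * c], hence [j], which is impossible for 0 < j < b. This makes the
    unity root sum applicable at [xi R b ^+ (j * c)]. *)
Lemma xi_expr_neq1 (R : realType) {b j c : nat} :
  (0 < j < b)%N -> coprime c b -> xi R b ^+ (j * c) != 1.
Proof.
case/andP=> j_gt0 j_lt_b cop.
have b_gt0 : (0 < b)%N by exact: leq_trans j_lt_b.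
rewrite -(prim_order_dvd (xi_prim_root R b_gt0)).
by rewrite Gauss_dvdl 1?coprime_sym // gtnNdvd.
Qed.

Lemma fdsum_rcons (R : realType) (s : seq nat) (c b : nat) (t : int) :
  (0 < b)%N -> coprime c b ->
  b%:R * fdsum R (rcons s c) b t =
  - \sum_(1 <= k < b) k%:R * fdsum R s b (t + k%:Z * c%:Z).
Proof.
move=> b_gt0 cop; have primxi := xi_prim_root R b_gt0.
(* Exponents are integers, possibly negative, so splitting a power of [xi R b] over a sum requires a
   nonzero base. *)
have xi_neq0 : xi R b != 0.
  apply/eqP => xi0; have := prim_expr_order primxi.
  by rewrite xi0 expr0n gtn_eqF // => /esym/eqP; rewrite oner_eq0.
rewrite /fdsum.
under [in RHS]eq_bigr do rewrite mulrCA mulr_sumr.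
(* With the sum over [j] outermost and the common factor 1/b removed, the identity can be checked
   for each [j] separately. *)
rewrite -mulr_sumr exchange_big /= mulrCA -mulrN; congr (_ * _).
rewrite mulr_sumr -sumrN; apply: eq_big_nat => j j_bounds.
have xij_neq1 := xi_expr_neq1 R j_bounds cop.
have xijb : (xi R b ^+ (j * c)) ^+ b = 1.
  by rewrite exprAC (prim_expr_order primxi) expr1n.
(* The [j]-th term without the factor of [c]. Shifting [t] by [k * c] multiplies it by the [k]-th
   power of [xi R b ^+ (j * c)]. *)
pose w := xi R b ^ (j%:Z * t) / \prod_(i <- s) (1 - xi R b ^+ (j * i)).
transitivity (- (w * \sum_(1 <= k < b) k%:R * (xi R b ^+ (j * c)) ^+ k)).
  rewrite (sum_natr_unity_root b_gt0 xijb xij_neq1) mulrN opprK /w.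
  by rewrite big_rcons /= invfM; ring.
congr (- _); rewrite mulr_sumr; apply: eq_bigr => k _.
have -> : j%:Z * (t + k%:Z * c%:Z) = j%:Z * t + (j * c * k)%N%:Z.
  by rewrite !PoszM; ring.
by rewrite expfzDr // -exprnP -exprM /w; ring.
Qed.

Theorem theorem15 (R : realType) (b d : nat) (a : d.-tuple nat)
    (hb : (2 <= b)%N) (hd : (1 <= d)%N)
    (ha : forall i : 'I_d, (0 < tnth a i)%N /\ coprime (tnth a i) b)
    (t : int) :
  b%:R * fdsum R a b t =
  - \sum_(1 <= k < b)
      k%:R * fdsum R (take d.-1 a) b (t + k%:Z * (nth 0%N a d.-1)%:Z).
Proof.
have last_lt : (d.-1 < d)%N by rewrite prednK.
have aE : a = rcons (take d.-1 a) (nth 0%N a d.-1) :> seq nat.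
  by rewrite -take_nth ?size_tuple // prednK // take_oversize ?size_tuple.
have [_ cop] := ha (Ordinal last_lt).
rewrite (tnth_nth 0%N) /= in cop.
by rewrite {1}aE fdsum_rcons // (leq_trans _ hb).
Qed.
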